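(* Let $P$ be a finite-rank ideal projector on $\mathbb{F}[x_1,\ldots,x_d]$ and let $\Lambda=\{\lambda_1,\ldots,\lambda_n\}$ be the set of interpolation conditions matched by $P$. For $1\le i\le d$, let $\prec_{lex(i)}$ be the lexicographic order with $x_i\succ\cdots\succ x_d\succ x_1\succ\cdots\succ x_{i-1}$. Then the following are equivalent: (a) $\ker P$ has a universal reduced Gröbner basis $G=\{g_1,\ldots,g_m\}$ (that is, $G$ is the reduced Gröbner basis of $\ker P$ with respect to every monomial order) whose elements have the form $$g_j=\bm{x}^{\bm{\alpha}^{(j)}}-\sum_{\bm{0}\le\bm{\beta}<\bm{\alpha}^{(j)}}c_{j,\bm{\beta}}\,\bm{x}^{\bm{\beta}},\qquad 1\le j\le m,\quad c_{j,\bm{\beta}}\in\mathbb{F};$$ (b) the Gröbner escaliers $\mathcal{N}_{\prec_{lex(1)}}(\ker\Lambda),\ \mathcal{N}_{\prec_{lex(2)}}(\ker\Lambda),\ \ldots,\ \mathcal{N}_{\prec_{lex(d)}}(\ker\Lambda)$ are identical.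
   Context: $\mathbb{F}$ is a field of characteristic zero and $\mathbb{F}[\bm{x}]=\mathbb{F}[x_1,\ldots,x_d]$. $\mathbb{N}$ denotes the nonnegative integers. For $\bm{\alpha},\bm{\beta}\in\mathbb{N}^d$, $\bm{\alpha}\le\bm{\beta}$ means $\alpha_i\le\beta_i$ for all $i$, and $\bm{\alpha}<\bm{\beta}$ means $\bm{\alpha}\le\bm{\beta}$ and $\bm{\alpha}\ne\bm{\beta}$. A linear operator $P:\mathbb{F}[\bm{x}]\to\mathbb{F}[\bm{x}]$ is an ideal projector if $P^2=P$ and $\ker P$ is an ideal; it is finite-rank if its range is finite-dimensional. The interpolation conditions matched by a finite-rank ideal projector $P$ form the finite-dimensional space $(\ker P)^\perp=\{\lambda\in(\mathbb{F}[\bm{x}])':\ker P\subset\ker\lambda\}$, where $(\mathbb{F}[\bm{x}])'$ is the algebraic dual; ''$\Lambda=\{\lambda_1,\ldots,\lambda_n\}$ is the set of interpolation conditions matched by $P$'' means that $\lambda_1,\ldots,\lambda_n$ is a basis of this space. Write $\ker\Lambda=\{f\in\mathbb{F}[\bm{x}]:\lambda(f)=0\text{ for all }\lambda\in\Lambda\}$; then $\ker\Lambda=\ker P$. For an ideal $\mathcal{I}$ and a monomial order $\prec$, the Gröbner escalier $\mathcal{N}_\prec(\mathcal{I})$ is the set of monomials not divisible by the leading term of any element of the reduced Gröbner basis of $\mathcal{I}$ with respect to $\prec$. *)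

(* Defs.v *)
(* MathComp, with the multinomials library. *)
From HB Require Import structures.
From mathcomp Require Import all_boot all_order all_algebra.
From mathcomp Require Import finmap.
From mathcomp Require Import mpoly.

Set Implicit Arguments.
Unset Strict Implicit.
Unset Printing Implicit Defensive.

Import Order.TTheory GRing.Theory.

Local Open Scope ring_scope.

(* Not [idealr_closed] of ring_quotient, which excludes the unit ideal: the
   kernel of the zero projector is the whole ring. *)
Definition is_ideal d (F : fieldType) (I : {mpoly F[d]} -> Prop) : Prop :=
  [/\ I 0,
      forall f g, I f -> I g -> I (f + g)
    & forall f g, I g -> I (f * g)].

Definition kerP d (F : fieldType) (P : {linear {mpoly F[d]} -> {mpoly F[d]}})
  (f : {mpoly F[d]}) : Prop := P f = 0.

Definition ideal_projector d (F : fieldType)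
    (P : {linear {mpoly F[d]} -> {mpoly F[d]}}) : Prop :=
  (forall f, P (P f) = P f) /\ is_ideal (kerP P).

Definition finite_rank d (F : fieldType)
    (P : {linear {mpoly F[d]} -> {mpoly F[d]}}) : Prop :=
  exists (r : nat) (b : 'I_r -> {mpoly F[d]}),
    forall f, exists c : 'I_r -> F, P f = \sum_k c k *: P (b k).

Definition perp d (F : fieldType) (I : {mpoly F[d]} -> Prop)
    (mu : {scalar {mpoly F[d]}}) : Prop :=
  forall f, I f -> mu f = 0.

(* [lam] is a basis of the subspace [perp (kerP P)] of the algebraic dual. *)
Definition conditions_matched d (F : fieldType) n
    (P : {linear {mpoly F[d]} -> {mpoly F[d]}})
    (lam : 'I_n -> {scalar {mpoly F[d]}}) : Prop :=
  [/\ forall k, perp (kerP P) (lam k),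
      forall c : 'I_n -> F,
        (forall f, \sum_k c k * lam k f = 0) -> forall k, c k = 0
    & forall mu : {scalar {mpoly F[d]}}, perp (kerP P) mu ->
        exists c : 'I_n -> F, forall f, mu f = \sum_k c k * lam k f].

Definition kerL d (F : fieldType) n (lam : 'I_n -> {scalar {mpoly F[d]}})
    (f : {mpoly F[d]}) : Prop :=
  forall k, lam k f = 0.

(* [le] is the non-strict order; that it is a well-order follows from [0] being
   the least element, by Dickson's lemma. *)
Definition monomial_order d (le : rel 'X_{1..d}) : Prop :=
  [/\ reflexive le, antisymmetric le, transitive le & total le] /\
  (forall m, le 0%MM m) /\
  (forall m m1 m2, le m1 m2 -> le (m + m1)%MM (m + m2)%MM).

(* The exponents are compared in the variable order
   i, i+1, ..., d-1, 0, ..., i-1, the variables being numbered from 0. *)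
Definition lex d (i : 'I_d) : rel 'X_{1..d} := fun m1 m2 =>
  let exps (m : 'X_{1..d}) : seqlexi nat :=
    [seq m j | j <- rot i (enum 'I_d)] in
  (exps m1 <= exps m2)%O.

Definition leading d (F : fieldType) (le : rel 'X_{1..d})
    (f : {mpoly F[d]}) (m : 'X_{1..d}) : Prop :=
  m \in msupp f /\ forall m', m' \in msupp f -> le m' m.

(* On monomials, [(m1 <= m2)%MM] is divisibility, i.e. the componentwise order
   of the exponents. *)
Definition groebner_basis d (F : fieldType) (le : rel 'X_{1..d})
    (I : {mpoly F[d]} -> Prop) (G : {fset {mpoly F[d]}}) : Prop :=
  (forall g, g \in G -> I g) /\
  (forall f a, I f -> leading le f a ->
     exists g b, [/\ g \in G, leading le g b & (b <= a)%MM]).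

Definition reduced_groebner_basis d (F : fieldType) (le : rel 'X_{1..d})
    (I : {mpoly F[d]} -> Prop) (G : {fset {mpoly F[d]}}) : Prop :=
  [/\ groebner_basis le I G,
      forall g, g \in G -> exists2 a, leading le g a & g@_a = 1
    & forall g h b m, g \in G -> h \in G -> h != g -> leading le h b ->
        m \in msupp g -> ~~ (b <= m)%MM].

Definition universal_reduced_groebner_basis d (F : fieldType)
    (I : {mpoly F[d]} -> Prop) (G : {fset {mpoly F[d]}}) : Prop :=
  forall le : rel 'X_{1..d},
    monomial_order le -> reduced_groebner_basis le I G.

(* For a monomial order and an ideal, the reduced basis [G] exists and is
   unique. *)
Definition escalier d (F : fieldType) (le : rel 'X_{1..d})
    (I : {mpoly F[d]} -> Prop) (m : 'X_{1..d}) : Prop :=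
  exists2 G, reduced_groebner_basis le I G &
    forall g a, g \in G -> leading le g a -> ~~ (a <= m)%MM.

(* x^a - \sum_(0 <= b < a) c_b x^b for the componentwise strict order; the bound
   on the degree of [b] only makes the index type finite. *)
Definition dominated_form d (F : fieldType) (g : {mpoly F[d]}) : Prop :=
  exists (a : 'X_{1..d}) (c : 'X_{1..d} -> F),
    g = 'X_[a] - \sum_(b : 'X_{1..d < (mdeg a).+1}
                       | (bmnm b <= a)%MM && (bmnm b != a))
                   c (bmnm b) *: 'X_[bmnm b].

(* Main.v *)
Require Import Defs.
From HB Require Import structures.
From mathcomp Require Import all_boot all_order all_algebra.
From mathcomp Require Import finmap.
From mathcomp Require Import mpoly ssrcomplements.
From Stdlib Require Import ClassicalEpsilon.

Set Implicit Arguments.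
Unset Strict Implicit.
Unset Printing Implicit Defensive.

Import Order.TTheory GRing.Theory.

Local Open Scope ring_scope.

(** Write I for the kernel of P, an ideal of finite codimension that coincides
    with the kernel of the interpolation conditions. A monomial is called
    initial for an order if it leads some element of I, and standard otherwise;
    the escalier is the set of standard monomials. Modulo I every monomial b has
    a normal form nf b, a combination of standard monomials that are not above b
    in the order. It depends only on the set of standard monomials, because
    a nonzero combination of standard monomials is never in I
    ([standard_ideal_eq0]).

    From (b) to (a): as the d lexicographic orders have the same standard
    monomials, they also have the same normal forms ([is_normal_form_eq]). So
    a monomial m of nf b is at most b for each of these orders, and comparing
    for lex(i) bounds the exponent of the leading variable x_i: m_i <= b_i for
    every i, that is, m divides b. The candidate basis consists of the x^a - nf a
    where a runs over the divisibility-minimal initial monomials; its elements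
    are dominated, so a leads x^a - nf a for every monomial order. It remains to
    see that no order has further initial monomials
    ([initial_of_dividing_normal_forms]): if a standard monomial a led f in I
    for some order, replace each monomial b of f by nf b. The result is in I and
    is a combination of standard monomials, hence is zero; yet its coefficient
    at a is that of f, because the other monomials b of f are smaller than a and
    a can occur in nf b only if it divides b.

    From (a) to (b): a dominated polynomial has the same leading monomial for
    all orders, so a universal basis with dominated elements determines the same
    initial monomials for all of them.

    Two existence facts support this. Since [escalier] asserts that a reduced
    basis exists, (b) would be void without [reduced_groebner_exists]; there,
    finiteness of the basis comes from finite codimension, which puts a pure
    power of each variable among the initial monomials
    ([pure_power_initial]). Normal forms are built by induction along the order,
    which needs the lexicographic orders to be well-founded ([wf_rotlex]). *)

(** * Monomial orders *)

Section Orders.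
Variable d : nat.
Implicit Types (m a b c : 'X_{1..d}) (le : rel 'X_{1..d}).

(** Stated as an induction principle for a reflexive order. *)
Definition wf_order le : Prop :=
  forall Q : 'X_{1..d} -> Prop,
    (forall a, (forall b, le b a -> b != a -> Q b) -> Q a) -> forall a, Q a.

(** [lex i] is [rotlex i]; a natural number as index provides the order
    [rotlex 0] even when there are no variables, so that this case needs no
    separate treatment. *)
Definition rotlex (k : nat) : rel 'X_{1..d} := fun m1 m2 =>
  let exps m : seqlexi nat := [seq m j | j <- rot k (enum 'I_d)] in
  (exps m1 <= exps m2)%O.

Lemma monomial_order_divides le a b :
  monomial_order le -> (a <= b)%MM -> le a b.
Proof.
move=> [_ [le0 leD]] ab.
by rewrite -(submK ab) addmC -{1}(addm0 a); apply: leD; apply: le0.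
Qed.

Lemma monomial_order_rotlex k : monomial_order (rotlex k).
Proof.
rewrite /rotlex; split; last split.
- split=> [m|m1 m2 /le_anti E|m2 m1 m3|m1 m2].
  + exact: le_refl.
  + apply/mnmP=> j.
    have /(nth_index j) jE : j \in rot k (enum 'I_d) by rewrite mem_rot mem_enum.
    have jlt : (index j (rot k (enum 'I_d)) < size (rot k (enum 'I_d)))%N.
      by rewrite index_mem mem_rot mem_enum.
    have := congr1 (nth 0%N ^~ (index j (rot k (enum 'I_d)))) E.
    by rewrite !(nth_map j) // jE.
  + exact: le_trans.
  + exact: le_total.
- move=> m; elim: (rot k _) => [//|j s IH] /=.
  by rewrite lexi_cons mnm0E leEnat leq0n /=; apply/implyP.
- move=> m m1 m2; elim: (rot k _) => [//|j s IH] /=.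
  rewrite !lexi_cons !mnmDE !leEnat !leq_add2l.
  by move=> /andP[-> /implyP h]; apply/implyP => /h.
Qed.

Lemma wf_rotlex k : wf_order (rotlex k).
Proof.
move=> Q; rewrite /rotlex.
set s := rot k _.
have inj m1 m2 : [seq m1 j | j <- s] = [seq m2 j | j <- s] -> m1 = m2.
  move=> E; have [[_ anti _ _] _] := monomial_order_rotlex k.
  by apply: anti; rewrite /rotlex -/s E lexx.
move=> IH m.
have [n szs] : exists n, size s == n by exists (size s).
pose tof m : n.-tuple nat := [tuple of map m (Tuple szs)].
move: {2}(tof m) (erefl (tof m)) => t.
elim/(@ltxwf _ nat): t m => [R ih|t iht m tE]; last first.
  apply: IH => m' le_m'm ne; apply: (iht (tof m')) => //.
  rewrite -tE; suff: ([seq m' j | j <- s] < [seq m j | j <- s] :> seqlexi nat)%O by [].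
  rewrite lt_neqAle le_m'm andbT.
  by apply: contra ne => /eqP /inj ->.
elim/ltn_ind => x IHx; apply: ih => y; rewrite ltEnat; exact: IHx.
Qed.

(** The variable [i] comes first in the order [rotlex i]. *)
Lemma rotlex_exponent (i : 'I_d) m1 m2 : rotlex i m1 m2 -> (m1 i <= m2 i)%N.
Proof.
rewrite /rotlex /rot (drop_nth i) ?size_enum_ord // nth_ord_enum /=.
by move/lexi_lehead.
Qed.

Lemma seq_greatest le (s : seq 'X_{1..d}) : monomial_order le -> s != [::] ->
  exists2 a, a \in s & forall b, b \in s -> le b a.
Proof.
move=> [[refl _ trans tot] _]; elim: s => [//|c s IH] _.
have [->|/IH[a ain amax]] := eqVneq s [::].
  by exists c => [|b]; rewrite inE // => /eqP ->.
have /orP[ca|ac] := tot c a.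
  exists a; first by rewrite inE ain orbT.
  by move=> b; rewrite inE => /predU1P[->|/amax].
exists c; first by rewrite inE eqxx.
by move=> b; rewrite inE => /predU1P[->|/amax/trans]; [|apply].
Qed.

End Orders.

Arguments rotlex d k : clear implicits.

(** * Ideals, initial monomials and normal forms *)

Section Ideals.
Variables (d : nat) (F : fieldType).
Implicit Types (m a b c : 'X_{1..d}) (le : rel 'X_{1..d}) (f p : {mpoly F[d]}).

Lemma leading_exists le f :
  monomial_order le -> f != 0 -> exists a, leading le f a.
Proof.
move=> le_mon; rewrite -msupp_eq0 => /(seq_greatest le_mon)[a ain amax].
by exists a.
Qed.

Lemma leading_unique le f a b :
  monomial_order le -> leading le f a -> leading le f b -> a = b.
Proof.
move=> [[_ anti _ _] _] [ain amax] [bin bmax].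
by apply: anti; rewrite amax // bmax.
Qed.

Lemma mem_msupp_sub_tail a p m :
  m \in msupp ('X_[a] - p) -> m = a \/ m \in msupp p.
Proof.
by move=> /msuppB_le; rewrite mem_cat msuppX inE => /orP[/eqP|]; [left|right].
Qed.

Lemma leading_sub_tail le a p : monomial_order le -> a \notin msupp p ->
  (forall b, b \in msupp p -> le b a) -> leading le ('X_[a] - p) a.
Proof.
move=> [[refl _ _ _] _] aNp pa; split.
  by rewrite mcoeff_msupp mcoeffB mcoeffX eqxx memN_msupp_eq0 // subr0 oner_eq0.
by move=> m /mem_msupp_sub_tail[->|/pa].
Qed.

Variable I : {mpoly F[d]} -> Prop.
Hypothesis idealI : is_ideal I.

Lemma idealZ (k : F) f : I f -> I (k *: f).
Proof. by case: idealI => _ _ IM If; rewrite -mul_mpolyC; apply: IM. Qed.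

Lemma idealB f p : I f -> I p -> I (f - p).
Proof.
case: idealI => _ ID _ If Ip; apply: ID => //.
by rewrite -scaleN1r; apply: idealZ.
Qed.

Lemma ideal_sum (T : eqType) (s : seq T) (G : T -> {mpoly F[d]}) :
  (forall t, t \in s -> I (G t)) -> I (\sum_(t <- s) G t).
Proof.
case: idealI => I0 ID _ IG; rewrite big_seq.
by apply: (big_ind I) => //; apply: ID.
Qed.

Definition initial le a : Prop := exists2 f, I f & leading le f a.

Lemma initial_divides le a b :
  monomial_order le -> initial le a -> (a <= b)%MM -> initial le b.
Proof.
move=> [_ [_ leD]] [f If [ain amax]] ab; exists (f * 'X_[b - a]).
  by rewrite mulrC; case: idealI => _ _; apply.
rewrite -{2}(submK ab); split.
  by rewrite (perm_mem (msuppMX _ _)) map_f.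
move=> m; rewrite (perm_mem (msuppMX _ _)) => /mapP[m' m'in ->].
by apply: leD; apply: amax.
Qed.

(** The leading monomial of a nonzero element of the ideal is initial. *)
Lemma standard_ideal_eq0 le p : monomial_order le -> I p ->
  (forall m, m \in msupp p -> ~ initial le m) -> p = 0.
Proof.
move=> le_mon Ip pstd; apply/eqP/negP => /negP /(leading_exists le_mon)[a pa].
by case: (pstd a); [case: pa | exists p].
Qed.

Definition is_normal_form le a r : Prop :=
  I ('X_[a] - r) /\ forall m, m \in msupp r -> ~ initial le m /\ le m a.

(** The difference of two normal forms of a monomial is in the ideal and involves
    only standard monomials; the order intervenes only through the latter. *)
Lemma is_normal_form_eq le le' a r r' : monomial_order le ->
  (forall m, initial le m <-> initial le' m) ->
  is_normal_form le a r -> is_normal_form le' a r' -> r = r'.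
Proof.
move=> le_mon same [Ir rstd] [Ir' r'std].
apply/eqP; rewrite -subr_eq0; apply/eqP; apply: (standard_ideal_eq0 le_mon).
  have -> : r - r' = ('X_[a] - r') - ('X_[a] - r).
    by rewrite [RHS]addrC opprB addrA addrNK.
  exact: idealB.
move=> m /msuppB_le; rewrite mem_cat => /orP[/rstd[]//|/r'std[h _]].
by move=> /same.
Qed.

(** An initial monomial is congruent to a combination of smaller monomials, to
    which well-founded induction applies. *)
Lemma normal_form_exists le a : monomial_order le -> wf_order le ->
  exists r, is_normal_form le a r.
Proof.
move=> le_mon wf; have [[refl anti trans _] _] := le_mon.
elim/wf: a => a IH.
case: (classic (initial le a)) => [[f If [ain amax]]|astd]; last first.
  exists 'X_[a]; split; first by rewrite subrr; case: idealI.
  by move=> m; rewrite msuppX inE => /eqP ->.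
have fa0 : f@_a != 0 by rewrite -mcoeff_msupp.
(* The ideal element f, made monic, rewrites the monomial a to q. *)
pose q := 'X_[a] - (f@_a)^-1 *: f.
have qlt b : b \in msupp q -> le b a /\ b != a.
  move=> bq; split.
    by case: (mem_msupp_sub_tail bq) => [->|/msuppZ_le/amax].
  apply: contraTneq bq => ->.
  by rewrite -mcoeff_eq0 mcoeffB mcoeffX mcoeffZ eqxx mulVf // subrr.
have /choice[nf nfP] : forall b, exists r, b \in msupp q -> is_normal_form le b r.
  move=> b; have [/qlt[ba nab]|] := boolP (b \in msupp q); last by exists 0.
  by have [r rP] := IH b ba nab; exists r.
exists (\sum_(b <- msupp q) q@_b *: nf b); split.
  set r := \sum_(b <- _) _.
  have -> : 'X_[a] - r = (f@_a)^-1 *: f + (q - r).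
    by rewrite [RHS]addrA /q [_ *: f + _]addrC addrNK.
  case: (idealI) => _ ID _; apply: ID; first exact: idealZ.
  rewrite {1}(mpolyE q) /r -sumrB; apply: ideal_sum => b /nfP[Ib _].
  by rewrite -scalerBr; apply: idealZ.
move=> m /msupp_sum_le /flatten_mapP[b].
rewrite filter_predT => bq /msuppZ_le min.
have [_ /(_ m min)[mstd mb]] := nfP b bq.
by split=> //; apply: trans mb _; case: (qlt b bq).
Qed.

(** * Minimal initial monomials *)

(** The quotient by the ideal has dimension at most r. *)
Definition codim_le (r : nat) : Prop :=
  forall s : 'I_r.+1 -> {mpoly F[d]},
    exists2 v : 'I_r.+1 -> F, exists k, v k != 0 & I (\sum_k v k *: s k).

(** The powers of exponent 0 to r of a variable are dependent modulo the ideal,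
    and the leading monomial of a dependency is one of them. *)
Lemma pure_power_initial le r (i : 'I_d) : monomial_order le -> codim_le r ->
  exists2 e, (e <= r)%N & initial le (U_(i) *+ e)%MM.
Proof.
move=> le_mon codim.
have [v [k vk]] := codim (fun j => 'X_[(U_(i) *+ j)%MM]).
set f := \sum_j _ => If.
have pow_inj (j j' : 'I_r.+1) : (U_(i) *+ j)%MM = (U_(i) *+ j')%MM -> j = j'.
  move=> /mnmP /(_ i); rewrite !mulmnE mnm1E eqxx !mul1n; exact: val_inj.
have fE (j : 'I_r.+1) : f@_(U_(i) *+ j) = v j.
  rewrite /f raddf_sum /= (bigD1 j) //= mcoeffZ mcoeffX eqxx mulr1.
  rewrite big1 ?addr0 // => j' nj; rewrite mcoeffZ mcoeffX.
  have /negPf -> : (U_(i) *+ j')%MM != (U_(i) *+ j)%MM.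
    by apply: contra nj => /eqP /pow_inj ->.
  by rewrite mulr0.
have f0 : f != 0 by apply: contraNneq vk => f0; rewrite -fE f0 mcoeff0.
have [a fa] := leading_exists le_mon f0.
have : a \in msupp f by case: fa.
rewrite /f => /msupp_sum_le /flatten_mapP[j _] /msuppZ_le.
rewrite msuppX inE => /eqP aE.
exists j; first by rewrite -ltnS ltn_ord.
by rewrite -aE; exists f.
Qed.

Definition minimal_initial le a : Prop :=
  initial le a /\ forall b, initial le b -> (b <= a)%MM -> b = a.

Lemma minimal_initial_below le a : initial le a ->
  exists2 b, minimal_initial le b & (b <= a)%MM.
Proof.
have [k] := ubnP (mdeg a); elim: k a => // k IH a; rewrite ltnS => ak ina.
case: (classic (exists2 b, initial le b & (b <= a)%MM /\ b <> a)).
  move=> [b inb [ba /eqP nba]].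
  have bk : (mdeg b < k)%N.
    apply: leq_trans ak; rewrite -(submK ba) mdegD.
    rewrite -[X in (X < _)%N]add0n ltn_add2r lt0n mdeg_eq0.
    by apply: contra nba => /eqP z; rewrite -(submK ba) z add0m.
  have [c cmin cb] := IH b bk inb.
  by exists c => //; apply: lepm_trans cb ba.
move=> none; exists a; last exact: lepm_refl.
split=> // b inb ba; apply: NNPP => nba.
by apply: none; exists b.
Qed.

(** No exponent of a minimal initial monomial exceeds r: otherwise an initial
    pure power given by [pure_power_initial] divides it properly. *)
Lemma finite_minimal_initial le r : monomial_order le -> codim_le r ->
  exists A : seq 'X_{1..d}, forall a, a \in A <-> minimal_initial le a.
Proof.
move=> le_mon codim.
have bound a : minimal_initial le a -> (mdeg a < (d * r).+1)%N.
  move=> [_ amin]; rewrite ltnS mdegE.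
  apply: (@leq_trans (\sum_(i < d) r)); last by rewrite sum_nat_const card_ord.
  apply: leq_sum => i _; have [e er ein] := pure_power_initial i le_mon codim.
  rewrite leqNgt; apply/negP => ra.
  suff ea : (U_(i) *+ e <= a)%MM.
    move: ra; rewrite -(amin _ ein ea) mulmnE mnm1E eqxx mul1n.
    by rewrite ltnNge er.
  apply/mnm_lepP => j; rewrite mulmnE mnm1E; case: eqP => [<-|]; last by [].
  by rewrite mul1n; apply: leq_trans er (ltnW ra).
pose minb (w : 'X_{1..d < (d * r).+1}) :=
  is_left (excluded_middle_informative (minimal_initial le w)).
exists [seq bmnm w | w <- enum minb] => a; split.
  move=> /mapP[b]; rewrite mem_enum unfold_in /minb.
  by case: excluded_middle_informative => // bmin _ ->.
move=> amin; apply/mapP; exists (BMultinom (bound a amin)) => //=.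
rewrite mem_enum unfold_in /minb.
by case: excluded_middle_informative.
Qed.

(** * Reduced bases *)

(** Serves twice: for one lexicographic order, and for an arbitrary order with
    the tails of that lexicographic order. *)
Lemma reduced_groebner_of_tails le (A : seq 'X_{1..d})
    (t : 'X_{1..d} -> {mpoly F[d]}) :
  monomial_order le ->
  (forall a, a \in A -> I ('X_[a] - t a)) ->
  (forall a b, a \in A -> b \in msupp (t a) ->
     le b a /\ forall c, c \in A -> ~~ (c <= b)%MM) ->
  (forall a b, a \in A -> b \in A -> (b <= a)%MM -> b = a) ->
  (forall a, initial le a -> exists2 b, b \in A & (b <= a)%MM) ->
  reduced_groebner_basis le I [fset g in [seq 'X_[a] - t a | a <- A]]%fset.
Proof.
move=> le_mon It tail anti gen.
have lead a : a \in A -> leading le ('X_[a] - t a) a.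
  move=> aA; apply: leading_sub_tail => //.
    by apply/negP => /(tail a a aA)[_ /(_ a aA)]; rewrite lepm_refl.
  by move=> b /(tail a b aA)[].
split.
- split=> [g|f a If fa].
    by rewrite inE => /mapP[a aA ->]; apply: It.
  have [|b bA ba] := gen a; first by exists f.
  exists ('X_[b] - t b), b; split=> //; last exact: lead.
  by rewrite inE; apply: map_f.
- move=> g; rewrite inE => /mapP[a aA ->]; exists a; first exact: lead.
  rewrite mcoeffB mcoeffX eqxx memN_msupp_eq0 ?subr0 //.
  by apply/negP => /(tail a a aA)[_ /(_ a aA)]; rewrite lepm_refl.
- move=> g h b m; rewrite !inE => /mapP[a aA ->] /mapP[a' a'A ->] ne.
  move=> /(leading_unique le_mon (lead a' a'A)) <-.
  move=> /mem_msupp_sub_tail[->|min]; last first.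
    by have [_ /(_ a' a'A)] := tail a m aA min.
  by apply: contra ne => /(anti a a' aA a'A) ->.
Qed.

(** Existence of a basis cannot be dropped, as [escalier] asserts it; which basis
    is chosen does not matter, since any basis detects the initial monomials. *)
Lemma escalierP le m : monomial_order le ->
  (exists G, reduced_groebner_basis le I G) ->
  escalier le I m <-> ~ initial le m.
Proof.
move=> le_mon [G Gred]; split=> [[H [[_ Hgen] _ _] Hm] [f If fm]|mstd].
  by have [g [b [gH gb bm]]] := Hgen f m If fm; move: (Hm g b gH gb); rewrite bm.
exists G => // g a gG ga; apply/negP => am; apply: mstd.
apply: initial_divides am => //; exists g => //.
by case: Gred => [[GI _] _ _]; apply: GI.
Qed.

Lemma reduced_groebner_exists le r :
  monomial_order le -> wf_order le -> codim_le r ->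
  exists G, reduced_groebner_basis le I G.
Proof.
move=> le_mon wf codim.
have [A AP] := finite_minimal_initial le_mon codim.
have /choice[nf nfP] : forall a, exists p, is_normal_form le a p.
  by move=> a; apply: normal_form_exists.
exists [fset g in [seq 'X_[a] - nf a | a <- A]]%fset.
apply: reduced_groebner_of_tails => //.
- by move=> a _; case: (nfP a).
- move=> a b _ bin; have [_ /(_ b bin)[bstd ba]] := nfP a.
  split=> // c /AP[cin _]; apply/negP => cb.
  by apply: bstd; apply: initial_divides cb.
- by move=> a b /AP[_ amin] /AP[bin _]; apply: amin.
- by move=> a /minimal_initial_below[b /AP bA ba]; exists b.
Qed.

(** The order [le] is arbitrary, and not known to be well-founded: instead of
    being reduced step by step, [f] is mapped to its normal form at once by
    linearity. If [a] were standard, the coefficient of [f] at [a] would survive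
    in this normal form, which is zero. *)
Lemma initial_of_dividing_normal_forms le0 le
    (nf : 'X_{1..d} -> {mpoly F[d]}) a :
  monomial_order le0 -> monomial_order le ->
  (forall b, is_normal_form le0 b (nf b)) ->
  (forall b m, m \in msupp (nf b) -> (m <= b)%MM) ->
  initial le a -> initial le0 a.
Proof.
move=> le0_mon le_mon nfP nf_div [f If [ain amax]].
apply: NNPP => astd.
have [[_ anti _ _] _] := le_mon.
pose p := \sum_(b <- msupp f) f@_b *: nf b.
have p0 : p = 0.
  apply: (standard_ideal_eq0 le0_mon).
    have -> : p = f - \sum_(b <- msupp f) f@_b *: ('X_[b] - nf b).
      rewrite {1}(mpolyE f) -sumrB; apply: eq_bigr => b _.
      by rewrite -scalerBr subKr.
    apply: idealB => //; apply: ideal_sum => b _; apply: idealZ.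
    by case: (nfP b).
  move=> m /msupp_sum_le /flatten_mapP[b _ /msuppZ_le min].
  by case: (nfP b) => _ /(_ m min)[].
have nfa : nf a = 'X_[a].
  have same m : initial le0 m <-> initial le0 m by [].
  apply: (is_normal_form_eq le0_mon same (nfP a)); split.
    by rewrite subrr; case: idealI.
  have [[refl _ _ _] _] := le0_mon.
  by move=> m; rewrite msuppX inE => /eqP ->.
(* A monomial b of f other than a contributes nothing: a in nf b would divide b,
   whereas b is smaller than a. *)
have pa : p@_a = f@_a.
  rewrite /p raddf_sum /= (bigD1_seq a) ?msupp_uniq //=.
  rewrite mcoeffZ nfa mcoeffX eqxx mulr1 big_seq_cond big1 ?addr0 //.
  move=> b /andP[bin nba]; rewrite mcoeffZ [X in _ * X]memN_msupp_eq0 ?mulr0 //.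
  apply: contra nba => /nf_div ab; apply/eqP/anti.
  by rewrite amax // (monomial_order_divides le_mon ab).
by move: ain; rewrite mcoeff_msupp -pa p0 mcoeff0 eqxx.
Qed.

End Ideals.

(** * Projectors and their interpolation conditions *)

Section Projectors.
Variables (d : nat) (F : fieldType) (P : {linear {mpoly F[d]} -> {mpoly F[d]}}).

(** The coefficients of [P f] are functionals of [f] that annihilate the kernel
    of [P], hence combinations of the interpolation conditions. *)
Lemma kerL_kerP n (lam : 'I_n -> {scalar {mpoly F[d]}}) f :
  conditions_matched P lam -> kerL lam f <-> kerP P f.
Proof.
move=> [lam_perp _ span]; split=> [lf0|Pf0]; last first.
  by move=> k; apply: lam_perp.
apply/mpolyP => m; rewrite mcoeff0.
have [|c cP] := span (mcoeff m \o P : {scalar {mpoly F[d]}}).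
  by move=> g Pg0 /=; rewrite Pg0 mcoeff0.
by rewrite -[LHS]/((mcoeff m \o P) f) cP big1 // => k _; rewrite lf0 mulr0.
Qed.

Lemma finite_rank_codim_le : finite_rank P -> exists r, codim_le (kerP P) r.
Proof.
move=> [r [b PE]]; exists r => s.
have /fin_all_exists[C CE] : forall k, exists c : 'I_r -> F,
  P (s k) = \sum_j c j *: P (b j) by move=> k; apply: PE.
pose M := \matrix_(k < r.+1, j < r) C k j.
have : kermx M != 0.
  rewrite kermx_eq0 /row_free neq_ltn; apply/orP; left.
  by rewrite ltnS rank_leq_col.
move=> /rowV0Pn[v /sub_kermxP vM0 /rV0Pn vn0].
exists (v 0) => //; rewrite /kerP linear_sum /=.
under eq_bigr => k _ do rewrite linearZ /= CE scaler_sumr.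
rewrite exchange_big big1 //= => j _.
under eq_bigr => k _ do rewrite scalerA.
rewrite -scaler_suml.
have -> : \sum_k v 0 k * C k j = (v *m M) 0 j.
  by rewrite mxE; apply: eq_bigr => k _; rewrite mxE.
by rewrite vM0 mxE scale0r.
Qed.

End Projectors.

(** * Dominated polynomials *)

Section DominatedForms.
Variables (d : nat) (F : fieldType).
Implicit Types (a b m : 'X_{1..d}).

Lemma dominated_form_sub_tail (a : 'X_{1..d}) (p : {mpoly F[d]}) :
  (forall m, m \in msupp p -> (m <= a)%MM && (m != a)) ->
  dominated_form ('X_[a] - p).
Proof.
move=> pa; exists a, (fun m => p@_m); congr (_ - _).
have sz : (msize p <= (mdeg a).+1)%N.
  rewrite msizeE; apply/bigmax_leqP_seq => m /pa /andP[ma _] _.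
  by rewrite ltnS -(submK ma) mdegD leq_addl.
rewrite {1}(mpolywE sz) [RHS]big_mkcond; apply: eq_bigr => m _ /=.
case: ifPn => // mNa; rewrite memN_msupp_eq0 ?scale0r //.
by apply: contra mNa => /pa.
Qed.

(** All monomial orders extend divisibility, so they agree on the leading
    monomial. *)
Lemma dominated_form_leading (g : {mpoly F[d]}) : dominated_form g ->
  exists a, forall le, monomial_order le -> leading le g a.
Proof.
move=> [a [c ->]]; exists a => le le_mon.
set p := \sum_(_ | _) _.
have pa m : m \in msupp p -> (m <= a)%MM && (m != a).
  move=> /msupp_sum_le /flatten_mapP[b]; rewrite mem_filter => /andP[ba _].
  by move=> /msuppZ_le; rewrite msuppX inE => /eqP ->.
apply: leading_sub_tail => //.
  by apply/negP => /pa; rewrite eqxx andbF.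
by move=> b /pa /andP[ba _]; apply: monomial_order_divides.
Qed.

End DominatedForms.

(** * The equivalence *)

Theorem proposition7 (F : fieldType) (charF0 : [pchar F] =i pred0) (d : nat)
    (P : {linear {mpoly F[d]} -> {mpoly F[d]}})
    (idealP : ideal_projector P) (finP : finite_rank P)
    (n : nat) (lam : 'I_n -> {scalar {mpoly F[d]}})
    (lamP : conditions_matched P lam) :
  (exists2 G : {fset {mpoly F[d]}},
     universal_reduced_groebner_basis (kerP P) G &
     forall g, g \in G -> dominated_form g)
  <->
  (forall (i j : 'I_d) (m : 'X_{1..d}),
     escalier (lex i) (kerL lam) m <-> escalier (lex j) (kerL lam) m).
Proof.
have [_ idealI] := idealP.
have kerLP f := kerL_kerP f lamP.
have idealL : is_ideal (kerL lam).
  case: idealI => I0 ID IM; split=> [|f g /kerLP If /kerLP Ig|f g /kerLP Ig].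
  - exact/kerLP.
  - by apply/kerLP/ID.
  - by apply/kerLP/IM.
have initialL le m : initial (kerL lam) le m <-> initial (kerP P) le m.
  by split=> -[f /kerLP If fm]; exists f.
have redL le G :
    reduced_groebner_basis le (kerP P) G -> reduced_groebner_basis le (kerL lam) G.
  move=> [[GI gen] lc1 red]; split=> //; split=> [g /GI /kerLP //|f a /kerLP].
  exact: gen.
have [r codim] := finite_rank_codim_le finP.
have lexP (k : nat) := monomial_order_rotlex d k.
have lex_escalier (i : 'I_d) m :
    escalier (lex i) (kerL lam) m <-> ~ initial (kerP P) (rotlex d i) m.
  have [G Gred] := reduced_groebner_exists idealI (lexP i) (@wf_rotlex d i) codim.
  rewrite -initialL; apply: (escalierP idealL m (lexP i)).
  by exists G; apply: redL.
split=> [[G Guniv Gdom] i j m|same_escalier].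
  have initial_le (i' j' : 'I_d) m' :
      initial (kerP P) (rotlex d i') m' -> initial (kerP P) (rotlex d j') m'.
    move=> [f If fm']; have [[GI gen] _ _] := Guniv _ (lexP i').
    have [g [b [gG gb bm']]] := gen f m' If fm'.
    apply: (initial_divides idealI) bm' => //; exists g; first exact: GI.
    have [a ga] := dominated_form_leading (Gdom g gG).
    rewrite -(leading_unique (lexP i') (ga _ (lexP i')) gb); exact: ga.
  rewrite !lex_escalier.
  by split=> mstd inm; apply: mstd; apply: initial_le inm.
(* Complements of equal escaliers. *)
have same_initial (i : 'I_d) m :
    initial (kerP P) (rotlex d 0) m <-> initial (kerP P) (rotlex d i) m.
  have d_gt0 : (0 < d)%N := leq_ltn_trans (leq0n i) (ltn_ord i).
  have := same_escalier (Ordinal d_gt0) i m; rewrite !lex_escalier /= => same.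
  by split=> inm; apply: NNPP => /same; apply.
have nf_exists k b := normal_form_exists idealI b (lexP k) (@wf_rotlex d k).
have /choice[nf nfP] := nf_exists 0.
(* The normal form of b is shared by all the orders, and the i-th one bounds the
   i-th exponent. *)
have nf_div b m : m \in msupp (nf b) -> (m <= b)%MM.
  move=> min; apply/mnm_lepP => i; apply: rotlex_exponent.
  have [p bp] := nf_exists i b.
  have nf_p := is_normal_form_eq idealI (lexP 0) (same_initial i) (nfP b) bp.
  by case: bp => _ /(_ m); rewrite -nf_p => /(_ min)[].
have [A AP] := finite_minimal_initial (lexP 0) codim.
have nf_std a m : m \in msupp (nf a) -> ~ initial (kerP P) (rotlex d 0) m.
  by case: (nfP a) => _ aP /aP[].
exists [fset g in [seq 'X_[a] - nf a | a <- A]]%fset => [le le_mon|g].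
  apply: reduced_groebner_of_tails => //.
  - by move=> a _; case: (nfP a).
  - move=> a b _ bin; split; first exact: monomial_order_divides (nf_div _ _ bin).
    move=> c /AP[cin _]; apply/negP => cb; apply: (nf_std a b bin).
    exact: initial_divides cb.
  - by move=> a b /AP[_ amin] /AP[bin _]; apply: amin.
  - move=> a /(initial_of_dividing_normal_forms idealI (lexP 0) le_mon nfP nf_div).
    by move=> /minimal_initial_below[b /AP bA ba]; exists b.
rewrite inE => /mapP[a /AP[ain _] ->]; apply: dominated_form_sub_tail => m min.
rewrite nf_div //=; apply/eqP => ma; move: (nf_std a m min); rewrite ma; exact.
Qed.
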